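(* Let $m\ge 1$ be an integer, $N=31^m$, $f=\phi(31^m)/10$ and $q=5^f$ (here $\mathrm{ord}_{31^m}(5)=\phi(31^m)/10$, so $N\mid q-1$). Let $\gamma$ be a fixed primitive element of $\mathbb{F}_q$, let $C_i=\{\gamma^{i+jN}\mid 0\le j\le\frac{q-1}{N}-1\}$ for $0\le i\le N-1$, and let $D=\bigcup_{i=0}^{31^{m-1}-1}C_i$. Then $\mathrm{Cay}(\mathbb{F}_q,D)$ is a strongly regular graph.
   Context: $\phi$ is the Euler totient function and $\mathrm{ord}_n(a)$ is the multiplicative order of $a$ modulo $n$. For $D\subseteq\mathbb{F}_q^*$ with $-D=D$, $\mathrm{Cay}(\mathbb{F}_q,D)$ is the graph with vertex set $\mathbb{F}_q$ in which two vertices are adjacent if and only if their difference belongs to $D$. A strongly regular graph srg$(v,k,\lambda,\mu)$ is a simple undirected regular graph of order $v$ and valency $k$, neither complete nor edgeless, such that any two adjacent vertices have exactly $\lambda$ common neighbors and any two (distinct) nonadjacent vertices have exactly $\mu$ common neighbors; connectedness is not required. *)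

(* Defs.v *)
From mathcomp Require Import all_boot all_order all_algebra.

Set Implicit Arguments.
Unset Strict Implicit.
Unset Printing Implicit Defensive.

Import GRing.Theory.
Local Open Scope ring_scope.

Section SimpleGraphs.
Variables (V : finType) (adj : rel V).

Definition neighbors (x : V) : {set V} := [set y | adj x y].

Definition simple_graph : Prop := symmetric adj /\ irreflexive adj.

Definition regular_graph (k : nat) : Prop := forall x, #|neighbors x| = k.

Definition complete_graph : Prop := forall x y, x != y -> adj x y.

Definition edgeless_graph : Prop := forall x y, ~~ adj x y.

(* Connectedness is not required. *)
Definition srg (v k lambda mu : nat) : Prop :=
  [/\ simple_graph /\ #|V| = v,
      regular_graph k,
      ~ complete_graph /\ ~ edgeless_graph,
      forall x y, adj x y -> #|neighbors x :&: neighbors y| = lambda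
    & forall x y, x != y -> ~~ adj x y ->
        #|neighbors x :&: neighbors y| = mu].

Definition strongly_regular : Prop := exists v k lambda mu, srg v k lambda mu.

End SimpleGraphs.

(* Defined for every connection set D.  The resulting relation is irreflexive
   iff 0 \notin D and symmetric iff D = - D; both are demanded by [srg]
   through [simple_graph]. *)
Definition Cay (F : finFieldType) (D : {set F}) : rel F :=
  fun x y => x - y \in D.

(* The class C_i of order N with respect to gamma in the field of order q. *)
Definition cyclotomic_class (F : finFieldType) (gamma : F) (q N i : nat) :
    {set F} :=
  [set gamma ^+ (i + j * N) | j : 'I_((q - 1) %/ N)].

(* Main.v *)
(* Write q = 5^f, L = 31^(m-1), N = 31 L, M = 5^c with f = 3 L = 2 c + 3, so that
   q = 125 M^2.  For b <> 0 let S(b) be the sum over x in D of psi(b x), with psi a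
   nontrivial additive character, and U(b) = 31 S(b) + 1.  D is stable under F_5^*,
   hence S(b) is an integer and U(b) = 1 mod 31.  Expanding the indicator of D in
   multiplicative characters, only characters of order exactly N occur in U(b), and
   Stickelberger's digit-sum formula shows that their Gauss sums are divisible by
   5 M at a prime above 5.  So U(b) lies in a residue class modulo 155 M in which
   125 M and -30 M are consecutive, and (U(b) - 125 M) (U(b) + 30 M) >= 0.  By
   Parseval these products sum to 0 over b <> 0, so S takes only two values away
   from 0, and Fourier inversion gives strong regularity.

   The Stickelberger bound is obtained without prime ideals or local fields: in
   Z[zeta] with a ring morphism to F, write G(k) for the Gauss sum of the k-th power
   of the inverse Teichmuller character.  G(k) G(1) = J G(k+1) with J not in the
   kernel unless p | k + 1, and G(p k) = G(k); so G(k) times a local unit is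
   G(1)^s(k), with s the base-p digit sum.  Taking k = q - 2 gives that G(1)^((p-1) f)
   is q times a local unit, and G(k) G(-k) = +-q turns the divisibility around. *)

Require Import Defs.
From mathcomp Require Import all_boot all_order all_algebra all_solvable all_field.
From mathcomp Require Import ring lra zify.

Set Implicit Arguments.
Unset Strict Implicit.
Unset Printing Implicit Defensive.

Import Order.TTheory GRing.Theory Num.Theory.
Local Open Scope ring_scope.

(** * Cyclotomic polynomials over Z and in an arbitrary field *)

(** [x] kills X^n - 1, hence some cyclotomic factor of index d dividing n; then x^d = 1 forces d =
    n. *)
Lemma root_Cyclotomic_prim (F : fieldType) n (x : F) :
  n.-primitive_root x -> root (map_poly intr (Cyclotomic n)) x.
Proof.
move=> prim_x; have n_gt0 := prim_order_gt0 prim_x.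
have evalXn d : (map_poly intr ('X^d - 1 : {poly int})).[x] = x ^+ d - 1.
  by rewrite rmorphB rmorph1 /= map_polyXn !hornerE.
have: (map_poly intr ('X^n - 1 : {poly int})).[x] == 0.
  by rewrite evalXn prim_expr_order // subrr.
rewrite -prod_Cyclotomic // rmorph_prod /= horner_prod.
rewrite prodf_seq_eq0 => /hasP[d]; rewrite -dvdn_divisors //= => d_dv_n rd.
suff /eqP <-: d == n by [].
rewrite eqn_dvd d_dv_n (prim_order_dvd prim_x) -subr_eq0 -evalXn.
have d_gt0: (0 < d)%N by apply: dvdn_gt0 d_dv_n.
rewrite -(prod_Cyclotomic d_gt0) rmorph_prod /= horner_prod.
by rewrite prodf_seq_eq0; apply/hasP; exists d => //; rewrite -dvdn_divisors.
Qed.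

(** Division by the monic cyclotomic polynomial stays in Z[X], and the remainder is too short to be
    a nonzero multiple of the minimal polynomial of [z]. *)
Lemma Cyclotomic_dvd n (z : algC) (P : {poly int}) :
    n.-primitive_root z -> (map_poly intr P).[z] = 0 ->
  exists Q, P = Q * Cyclotomic n.
Proof.
move=> prim_z Pz0; have mon := Cyclotomic_monic n.
exists (Pdiv.CommonRing.rdivp P (Cyclotomic n)).
have divP := Pdiv.RingMonic.rdivp_eq mon P.
set R := Pdiv.CommonRing.rmodp _ _ in divP.
have ltR : (size R < size (Cyclotomic n))%N.
  by rewrite Pdiv.CommonRing.ltn_rmodp monic_neq0.
suff R0: R = 0 by rewrite [LHS]divP R0 addr0.
have Rz0: root (map_poly intr R) z.
  move: Pz0; rewrite divP rmorphD rmorphM /= hornerD hornerM.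
  have /eqP -> := root_Cyclotomic_prim prim_z.
  by rewrite mulr0 add0r => /eqP.
have [r [Dr _] dv_r] := minCpolyP z.
have Rr: map_poly (intr : int -> algC) R = map_poly ratr (map_poly intr R).
  by rewrite -map_poly_comp; apply: eq_map_poly => b; rewrite /= rmorph_int.
move: Rz0; rewrite Rr dv_r => /dvdp_leq; rewrite -size_poly_eq0.
have szR: size (map_poly (intr : int -> rat) R) = size R.
  by rewrite size_map_inj_poly //; exact: intr_inj.
have szr: size r = size (Cyclotomic n).
  rewrite -(size_map_poly (ratr : {rmorphism rat -> algC})) -Dr.
  rewrite (minCpoly_cyclotomic prim_z) -(Cintr_Cyclotomic prim_z).
  by rewrite size_map_inj_poly //; exact: intr_inj.
rewrite szR szr size_poly_eq0.
by have [// | _ /(_ isT)] := eqVneq R 0; rewrite leqNgt ltR.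
Qed.

(* [red z y] says that [z], an element of Z[zeta], has residue [y] modulo the
   prime ideal that is the kernel of the morphism Z[zeta] -> F, zeta |-> delta. *)
Section Residue.
Variables (F : fieldType) (n : nat) (zeta : algC) (delta : F).
Hypotheses (zetaP : n.-primitive_root zeta) (deltaP : n.-primitive_root delta).

Definition red (z : algC) (y : F) : Prop :=
  exists2 P : {poly int}, z = (map_poly intr P).[zeta]
                        & y = (map_poly intr P).[delta].

(** This makes reduction well defined: a polynomial that kills [zeta] is a multiple of the
    cyclotomic polynomial, which [delta] also kills. *)
Lemma red0_eq0 y : red 0 y -> y = 0.
Proof.
case=> P /esym /(Cyclotomic_dvd zetaP)[Q ->] ->.
rewrite rmorphM /= hornerM.
by have /eqP -> := root_Cyclotomic_prim deltaP; rewrite mulr0.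
Qed.

Lemma red_zeta : red zeta delta.
Proof. by exists 'X; rewrite map_polyX hornerX. Qed.

Lemma red_int i : red i%:~R i%:~R.
Proof. by exists i%:P; rewrite map_polyC hornerC. Qed.

Lemma red_nat i : red i%:R i%:R.
Proof. exact: (red_int i). Qed.

Lemma redD z1 z2 y1 y2 : red z1 y1 -> red z2 y2 -> red (z1 + z2) (y1 + y2).
Proof.
by case=> [P -> ->] [Q -> ->]; exists (P + Q); rewrite rmorphD /= hornerD.
Qed.

Lemma redM z1 z2 y1 y2 : red z1 y1 -> red z2 y2 -> red (z1 * z2) (y1 * y2).
Proof.
by case=> [P -> ->] [Q -> ->]; exists (P * Q); rewrite rmorphM /= hornerM.
Qed.

Lemma redN z y : red z y -> red (- z) (- y).
Proof. by case=> [P -> ->]; exists (- P); rewrite rmorphN /= hornerN. Qed.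

Lemma redX z y i : red z y -> red (z ^+ i) (y ^+ i).
Proof. by case=> [P -> ->]; exists (P ^+ i); rewrite rmorphXn /= horner_exp. Qed.

Lemma red_sum (I : finType) (A : pred I) z y :
    (forall i, A i -> red (z i) (y i)) ->
  red (\sum_(i | A i) z i) (\sum_(i | A i) y i).
Proof.
by move=> zy; elim/big_rec2: _ => [|i *]; [exact: (red_nat 0) | apply: redD; auto].
Qed.

Lemma red_inj z y1 y2 : red z y1 -> red z y2 -> y1 = y2.
Proof.
move=> zy1 /redN zy2; apply/eqP; rewrite -subr_eq0; apply/eqP/red0_eq0.
by rewrite -(subrr z); apply: redD.
Qed.

End Residue.

(** * Powers of 5 modulo powers of 31 *)

Section Orders31.
Local Open Scope nat_scope.

(** Modulo 961 the i-th power is 1 + 31 u i, and 0 + ... + 30 = 465 = 15 * 31. So 31 divides the sum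
    exactly once, which drives both lifting inductions below. *)
Lemma sum_pow1_31 u :
  exists w, \sum_(i < 31) (31 * u + 1) ^ i = 31 + 961 * w.
Proof.
have powX i : exists w, (31 * u + 1) ^ i = 1 + 31 * u * i + 961 * w.
  elim: i => [|i [w IHi]]; first by exists 0; rewrite expn0 !muln0.
  by exists (w + u * (u * i) + 31 * u * w); rewrite expnS IHi; ring.
have sumX k : exists w, \sum_(i < k) (31 * u + 1) ^ i =
    k + 31 * u * (\sum_(i < k) i) + 961 * w.
  elim: k => [|k [w IHk]]; first by exists 0; rewrite !big_ord0 !muln0.
  have [w' kE] := powX k; exists (w + w').
  by rewrite !big_ord_recr /= IHk kE; ring.
have [w ->] := sumX 31; exists (15 * u + w).
by rewrite (_ : \sum_(i < 31) i = 465) ?[LHS]/=; [lia | rewrite !big_ord_recl big_ord0].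
Qed.

Lemma pow125_mod31 d : exists u, 125 ^ d = 31 * u + 1.
Proof.
elim: d => [|d [u IHd]]; first by exists 0.
by exists (125 * u + 4); rewrite expnS IHd; lia.
Qed.

Lemma subn1_exp31 x : x ^ 31 - 1 = (x - 1) * \sum_(i < 31) x ^ i.
Proof. by rewrite !subn1 predn_exp. Qed.

Lemma dvdn_pow125 m : 31 ^ m.+1 %| 125 ^ (31 ^ m) - 1.
Proof.
elim: m => [//|m IHm]; rewrite expnSr [X in 125 ^ X]expnSr expnM subn1_exp31.
apply: dvdn_mul IHm _; have [u ->] := pow125_mod31 (31 ^ m).
by have [w ->] := sum_pow1_31 u; lia.
Qed.

(** First 31 divides [d], by working modulo 961; then passing from [d] to [d1 = d / 31] removes
    exactly one factor 31 on each side. *)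
Lemma dvdn_pow125_order m d : 31 ^ m.+1 %| 125 ^ d - 1 -> 31 ^ m %| d.
Proof.
elim: m d => [|m IHm] d; first by rewrite dvd1n.
move=> dv.
have /dvdnP[d1 dE]: 31 %| d.
  have: 961 %| 125 ^ d - 1.
    by apply: dvdn_trans dv; rewrite (@dvdn_exp2l 31 2 m.+2).
  (* As 124 = 4 * 31, the square of 124 vanishes modulo 961. *)
  have [w ->]: exists w, 125 ^ d = 1 + 124 * d + 961 * w.
    elim: d {dv} => [|d [w IHd]]; first by exists 0.
    by exists (125 * w + 16 * d); rewrite expnS IHd; lia.
  by move=> h; lia.
have [u uE] := pow125_mod31 d1; have [w wE] := sum_pow1_31 u.
move: dv; rewrite dE expnM subn1_exp31 uE wE.
rewrite (_ : 31 + 961 * w = (31 * w + 1) * 31); last by lia.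
rewrite [31 ^ m.+2]expnSr mulnA dvdn_pmul2r // Gauss_dvdl; last first.
  by rewrite coprimeXl // prime_coprime //; lia.
by rewrite -uE => /IHm dv1; rewrite expnSr dvdn_pmul2r.
Qed.

(** 125 is 1 modulo 31 and has order [31 ^ m] modulo [31 ^ m.+1], so its powers carry [s] through
    its whole class modulo 31. *)
Lemma orbit_pow125 m s : ~~ (31 %| s) ->
  \sum_(i < 31 ^ m) (125 ^ i * s) %% 31 ^ m.+1 =
  \sum_(y < 31 ^ m) (31 * y + s %% 31).
Proof.
move=> s31; set L := 31 ^ m; set N := 31 ^ m.+1.
have NE : N = 31 * L by rewrite /N expnS.
have L_gt0 : 0 < L by rewrite expn_gt0.
have N_gt0 : 0 < N by rewrite expn_gt0.
pose h (i : 'I_L) := (125 ^ i * s) %% N.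
have hmod i : h i %% 31 = s %% 31.
  rewrite /h modn_dvdm; last by rewrite NE dvdn_mulr.
  by have [u ->] := pow125_mod31 i; rewrite mulnDl mul1n -mulnA mulnC modnMDl.
have hlt i : h i %/ 31 < L by rewrite ltn_divLR // mulnC -NE ltn_pmod.
pose g i := Ordinal (hlt i).
have hE i : h i = 31 * g i + s %% 31 by rewrite -(hmod i) mulnC /= -divn_eq.
have cop k : coprime N (125 ^ k * s).
  by rewrite coprimeXl // coprimeMr coprimeXr //= prime_coprime.
have inj (i j : 'I_L) : h i = h j -> i <= j -> i = j.
  move=> hij le_ij; apply/val_inj/eqP; rewrite /= eqn_leq le_ij -subn_eq0.
  move/eqP: hij; rewrite /h eq_sym eqn_mod_dvd; last first.
    by rewrite leq_mul2r leq_exp2l ?le_ij ?orbT.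
  rewrite -{1}(subnK le_ij) expnD -[X in _ - X]mul1n -mulnA -mulnBl Gauss_dvdl ?cop //.
  move/dvdn_pow125_order => /dvdnP[[|d] e]; first by rewrite e.
  by have := ltn_ord j; rewrite -/L in e; nia.
have g_inj : injective g.
  move=> i j /(congr1 val) e; have hij : h i = h j by rewrite !hE e.
  by case/orP: (leq_total i j) => [/inj-> // | /inj-> //].
by rewrite [RHS](reindex_inj g_inj); apply: eq_bigr => i _; exact: hE.
Qed.

(** Splitting j = 3 i + k gives three full classes modulo 31, those of t, 5 t and 25 t; [r] is the
    sum of their least residues divided by 31. This is the digit-sum estimate fed to the
    Stickelberger bound. *)
Lemma orbit_pow5 m t : ~~ (31 %| t) ->
  exists2 r, 0 < r <= 2 &
    \sum_(j < 3 * 31 ^ m) (5 ^ j * t) %% 31 ^ m.+1 =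
      (3 * (31 ^ m - 1)) %/ 2 * 31 ^ m.+1 + r * 31 ^ m.+1.
Proof.
move=> t31; set L := 31 ^ m; set N := 31 ^ m.+1.
have NE : N = 31 * L by rewrite /N expnS.
have oddL : odd L by rewrite oddX orbT.
have sumL s : ~~ (31 %| s) -> \sum_(i < L) (125 ^ i * s) %% N =
    (L * (L - 1)) %/ 2 * 31 + L * (s %% 31).
  move=> /orbit_pow125 ->; rewrite big_split /= sum_nat_const card_ord -big_distrr /=.
  rewrite -(big_mkord xpredT (fun i => i)) bin2_sum bin2 -divn2 subn1.
  by rewrite mulnC [in LHS]addnC [in RHS]addnC.
have ndv5 k : ~~ (31 %| 5 ^ k * t).
  by rewrite Gauss_dvdr // coprimeXr.
have -> : \sum_(j < 3 * L) (5 ^ j * t) %% N =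
    \sum_(k < 3) \sum_(i < L) (125 ^ i * (5 ^ k * t)) %% N.
  rewrite exchange_big /=; elim: (L) => [|K IHK]; first by rewrite muln0 !big_ord0.
  rewrite mulnS addnC addn3 !big_ord_recr /= IHK big_ord0 add0n -!addnA.
  have e5 j : 5 ^ (3 * K + j) = 125 ^ K * 5 ^ j by rewrite expnD expnM.
  by rewrite !mulnA -!e5 addn0 addn1 -expnSr.
have sum5 : exists2 r, 0 < r <= 2 & \sum_(k < 3) (5 ^ k * t) %% 31 = 31 * r.
  rewrite !big_ord_recr big_ord0 /= add0n expn0 expn1 mul1n.
  have a_lt : t %% 31 < 31 by rewrite ltn_mod.
  have a_gt : 0 < t %% 31 by rewrite lt0n.
  rewrite -[(5 * t) %% _]modnMmr -[(5 ^ 2 * t) %% _]modnMmr.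
  move: (t %% 31) a_lt a_gt => a a_lt a_gt.
  (* Since 1 + 5 + 25 = 31 the sum is a multiple of 31, and it lies strictly between 0 and 93. *)
  have /allP/(_ a): all (fun a => let x := a + (5 * a) %% 31 + (5 ^ 2 * a) %% 31 in
    (x == 31) || (x == 62)) (iota 1 30) by [].
  rewrite mem_iota a_gt => /(_ a_lt).
  case/orP => /eqP ->; [by exists 1 | by exists 2].
have [r r_bd rE] := sum5; exists r => //.
under eq_bigr do rewrite sumL //.
rewrite big_split /= sum_nat_const card_ord -big_distrr /= rE NE.
have -> : 3 * (L * (L - 1) %/ 2 * 31) = 3 * (L - 1) %/ 2 * (31 * L).
  have [l ->] : exists l, L = 2 * l + 1 by exists (L %/ 2); lia.
  rewrite addnK (_ : (2 * l + 1) * (2 * l) = (2 * l + 1) * l * 2); last by ring.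
  by rewrite (_ : 3 * (2 * l) = 3 * l * 2) ?mulnK //; ring.
by ring.
Qed.

End Orders31.

(** * Orthogonality and periodic sums *)

Lemma sum_prim_pow N (w : algC) a : N.-primitive_root w ->
  \sum_(t < N) w ^+ (t * a) = N%:R * (N %| a)%:R.
Proof.
move=> wP; under eq_bigr do rewrite mulnC exprM.
have [dv | ndv] := boolP (N %| a)%N.
  have /eqP -> : w ^+ a == 1 by rewrite -(prim_order_dvd wP).
  rewrite mulr1 (eq_bigr (fun=> 1)) ?sumr_const ?card_ord // => i _.
  by rewrite expr1n.
have := subrX1 (w ^+ a) N; rewrite -exprM mulnC exprM (prim_expr_order wP) expr1n.
rewrite subrr => /esym/eqP; rewrite mulf_eq0 subr_eq0 -(prim_order_dvd wP).
by rewrite (negPf ndv) mulr0 => /eqP.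
Qed.

Lemma sum_periodic (R : nmodType) (g : nat -> R) r L :
    (forall i, g (i + L)%N = g i) ->
  \sum_(i < r * L) g i = (\sum_(i < L) g i) *+ r.
Proof.
move=> gL; rewrite -!(big_mkord xpredT) big_nat_mul.
rewrite (eq_bigr (fun=> \sum_(0 <= i < L) g i)) => [|i _].
  by rewrite sumr_const_nat subn0.
rewrite -{1}[(i * L)%N]add0n mulSn big_addn addnK; apply: eq_bigr => j _.
by elim: i => [|i IHi]; rewrite ?addn0 // mulSnr addnA gL.
Qed.

Lemma sum_mult_fun0 (F : finFieldType) (R : idomainType) (h : F -> R) (c : F) :
    {morph h : x y / x * y} -> c != 0 -> h c != 1 ->
  \sum_(x | x != 0) h x = 0.
Proof.
move=> hM c0 hc1; set S := LHS.
have: h c * S = S.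
  rewrite /S mulr_sumr [RHS](reindex_inj (mulfI c0)) /=.
  by apply: eq_big => x; rewrite ?hM // mulf_eq0 (negPf c0).
move/eqP; rewrite -{2}[S]mul1r -subr_eq0 -mulrBl mulf_eq0 subr_eq0 (negPf hc1).
by move/eqP.
Qed.

(** * Base-p digit sums through cyclic rotations of the digits *)

Section Weight.
Variables (p f n : nat).
Hypotheses (p_pr : prime p) (f_gt0 : (0 < f)%N) (nE : (n.+1 = p ^ f)%N).

(* For k < n, [p.-1 * weight k = n * s k] where [s k] is the base-p digit sum of k. *)
Definition weight (k : nat) : nat := (\sum_(j < f) (p ^ j * k) %% n)%N.

(** Since p^f is 1 modulo [n], multiplication by [p] permutes the summands cyclically. *)
Lemma weight_frob k : weight (p * k) = weight k.
Proof.
rewrite /weight; case: f f_gt0 nE => // f' _ nE'.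
rewrite big_ord_recr [in RHS]big_ord_recl /= expn0 mul1n addnC; congr (_ + _)%N.
  by rewrite mulnA -expnSr -nE' mulnC mulnS addnC modnMDl.
by apply: eq_bigr => i _; rewrite mulnA -expnSr.
Qed.

(** Multiplying by [P] modulo P E - 1 rotates the digits: the high block [k %/ E] and the low block
    [k %% E] trade places. *)
Lemma modn_rotate P E k : (P * E = n.+1)%N -> (k < n)%N ->
  (P * k %% n = k %/ E + (k %% E) * P)%N.
Proof.
move=> PE k_lt; have E_gt0 : (0 < E)%N by case: (E) PE => //; rewrite muln0.
have P_gt0 : (0 < P)%N by case: (P) PE.
have -> : (P * k = (k %/ E) * n + (k %/ E + (k %% E) * P))%N.
  rewrite {1}(divn_eq k E) mulnDr mulnCA PE; lia.
rewrite modnMDl modn_small //.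
have aP : (k %/ E < P)%N by rewrite ltn_divLR // PE; lia.
have := ltn_mod k E; rewrite E_gt0 => bE.
have kE := divn_eq k E.
have : (k %/ E + k %% E * P <= n)%N by nia.
(* Equality would make both blocks maximal, that is k = n. *)
rewrite leq_eqVlt => /orP[/eqP e|//]; exfalso.
have bE' : (k %% E).+1 = E by nia.
have aP' : (k %/ E).+1 = P by nia.
nia.
Qed.

Lemma sum_expn : (p.-1 * \sum_(j < f) p ^ j = n)%N.
Proof. by rewrite -predn_exp -nE. Qed.

(** Without a carry only the last digit grows, so the j-th rotation grows by p^j. *)
Lemma weight_step k : (k.+1 < n)%N -> ~~ (p %| k.+1)%N ->
  (p.-1 * weight k.+1 = p.-1 * weight k + n)%N.
Proof.
move=> k_lt ndv; rewrite -{1}sum_expn -mulnDr -big_split /=; congr (_ * _)%N.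
apply: eq_bigr => j _; have j_lt := ltn_ord j.
have PE : (p ^ j * p ^ (f - j) = n.+1)%N by rewrite -expnD subnKC ?nE // ltnW.
rewrite (modn_rotate PE k_lt) (modn_rotate PE (ltnW k_lt)) modnS.
rewrite divnS ?expn_gt0 ?prime_gt0 //.
rewrite (_ : (_ %| _)%N = false) ?add0n ?mulSn; first by lia.
apply: contraNF ndv => /(dvdn_trans _); apply.
by rewrite -[(f - j)%N]prednK ?subn_gt0 // expnS dvdn_mulr.
Qed.

Lemma expn_ltn j : (1 < n)%N -> (j < f)%N -> (p ^ j < n)%N.
Proof.
move=> n_gt1 j_lt; have := prime_gt1 p_pr => p_gt1.
have: (p * p ^ j <= p ^ f)%N by rewrite -expnS leq_exp2l.
have : (0 < p ^ j)%N by rewrite expn_gt0 ltnW.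
by rewrite -nE; nia.
Qed.

(** p^j (n - 1) is - p^j modulo [n]. This is the digit sum of q - 2, one less than the maximum. *)
Lemma weight_max : (1 < n)%N -> (weight n.-1 + \sum_(j < f) p ^ j = f * n)%N.
Proof.
move=> n_gt1; rewrite -big_split /= -[f in RHS]card_ord -sum_nat_const.
apply: eq_bigr => j _; have lt_n := expn_ltn n_gt1 (ltn_ord j).
have p_gt0 : (0 < p ^ j)%N by rewrite expn_gt0 prime_gt0.
have -> : (p ^ j * n.-1 = (p ^ j).-1 * n + (n - p ^ j))%N by nia.
by rewrite modnMDl modn_small; lia.
Qed.

Lemma weight_pred : (p < n)%N -> weight p.-1 = n.
Proof.
move=> p_lt; rewrite -[RHS]sum_expn big_distrr; apply: eq_bigr => j _ /=.
rewrite mulnC modn_small //.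
have p_gt1 := prime_gt1 p_pr.
have f_gt1 : (1 < f)%N.
  by case: f f_gt0 nE => [|[|]] // _; rewrite expn1; lia.
have: (p ^ j * p <= p ^ f)%N by rewrite -expnSr leq_exp2l.
have [-> | j0] := posnP j; first by rewrite expn0; lia.
have : (p ^ 1 <= p ^ j)%N by rewrite leq_exp2l.
rewrite -nE expn1 -subn1 mulnBl mul1n mulnC; lia.
Qed.

End Weight.

(** * Gauss sums *)

Section GaussSums.
Variables (F : finFieldType) (p f n : nat) (eps zeta : algC) (delta : F).
Hypotheses (p_pr : prime p) (f_gt0 : (0 < f)%N) (cardF : #|F| = (p ^ f)%N).
Hypotheses (nE : (n.+1 = p ^ f)%N) (eps_prim : p.-primitive_root eps).
Hypotheses (zetaP : n.-primitive_root zeta) (deltaP : n.-primitive_root delta).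
Hypothesis deltaVP : n.-primitive_root delta^-1.

(* Since [chi] below sends delta to zeta, mapping zeta to delta^-1 makes [chi] the
   inverse of the Teichmuller character of the chosen prime. *)
Local Notation red := (red zeta delta^-1).

(** * The trace and the additive character *)

Lemma pcharF : p \in [pchar F].
Proof. exact: card_finPcharP cardF p_pr. Qed.

Definition ftrace (x : F) : F := \sum_(j < f) x ^+ (p ^ j).

Lemma ftraceD x y : ftrace (x + y) = ftrace x + ftrace y.
Proof.
rewrite -big_split; apply: eq_bigr => j _ /=; apply: exprDn_pchar.
by apply/pnatP => [|r r_pr]; rewrite ?expn_gt0 ?prime_gt0 // (Euclid_dvdX _ _ r_pr)
  dvdn_prime2 // => /andP[/eqP-> _]; exact: pcharF.
Qed.

Lemma ftrace0 : ftrace 0 = 0.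
Proof. by rewrite /ftrace big1 // => j _; rewrite expr0n expn_eq0 eqn0Ngt prime_gt0. Qed.

Lemma ftrace_frob x : ftrace (x ^+ p) = ftrace x.
Proof.
rewrite /ftrace; case: f f_gt0 cardF => // f' _ cF.
rewrite (eq_bigr (fun j : 'I_f'.+1 => x ^+ (p ^ j.+1))) => [|j _]; last first.
  by rewrite -exprM -expnS.
rewrite big_ord_recr big_ord_recl /= -cF expf_card addrC expn0 expr1.
by congr (_ + _).
Qed.

Lemma ftraceX x : ftrace x ^+ p = ftrace x.
Proof.
rewrite -(pFrobenius_autE pcharF) rmorph_sum /= -[RHS]ftrace_frob.
by apply: eq_bigr => j _; rewrite pFrobenius_autE -!exprM mulnC.
Qed.

Lemma natr_eqF i j : (i%:R == j%:R :> F) = (i == j %[mod p])%N.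
Proof.
have aux a b : (a <= b)%N -> (a%:R == b%:R :> F) = (a == b %[mod p]).
  move=> le_ab; rewrite eq_sym [in RHS]eq_sym eqn_mod_dvd //.
  by rewrite -subr_eq0 -natrB // -(dvdn_pcharf pcharF).
by case/orP: (leq_total i j) => /aux; rewrite // eq_sym => ->; rewrite eq_sym.
Qed.

Lemma prime_subfieldP (x : F) : x ^+ p = x -> exists i : 'I_p, i%:R = x.
Proof.
move=> xp; pose P : {poly F} := 'X^p - 'X.
have szP : size P = p.+1.
  by rewrite /P size_polyDl ?size_polyXn // size_polyN size_polyX ltnS prime_gt1.
have P_nz : P != 0 by rewrite -size_poly_eq0 szP.
pose s : seq F := [seq (i : nat)%:R | i : 'I_p].
have s_uniq : uniq s.
  rewrite map_inj_uniq ?enum_uniq // => i j /eqP; rewrite natr_eqF !modn_small //.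
  by move/eqP/val_inj.
have [/mapP[i _ ->] | xs] := boolP (x \in s); first by exists i.
suff: (size (x :: s) < size P)%N by rewrite szP /= size_map size_enum_ord ltnn.
apply: max_poly_roots; rewrite //= ?xs //.
apply/andP; split; first by rewrite /root /P !hornerE xp subrr.
apply/allP=> _ /mapP[i _ ->]; rewrite /root /P !hornerE.
by rewrite -(pFrobenius_autE pcharF) pFrobenius_aut_nat subrr.
Qed.

(** The trace is a polynomial of degree p^(f-1) < q, so it cannot vanish on all of [F]. *)
Lemma ftrace_neq0 : exists x, ftrace x != 0.
Proof.
case: (pickP (fun x => ftrace x != 0)) => [x ? | tr0]; first by exists x.
pose P : {poly F} := \sum_(j < f) 'X^(p ^ j).
have PE x : P.[x] = ftrace x.
  by rewrite /P horner_sum; apply: eq_bigr => j _; rewrite hornerXn.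
have szP : size P = (p ^ f.-1).+1.
  rewrite /P; case: f f_gt0 => // f' _; rewrite big_ord_recr /= addrC.
  rewrite size_polyDl size_polyXn // ltnS; apply: (leq_trans (size_sum _ _ _)).
  by apply/bigmax_leqP => i _; rewrite size_polyXn ltn_exp2l ?prime_gt1.
have P_nz : P != 0 by rewrite -size_poly_eq0 szP.
have: (size (enum F) < size P)%N.
  apply: max_poly_roots; rewrite ?enum_uniq //; apply/allP => x _.
  by rewrite /root PE; have /negbFE := tr0 x.
by rewrite -cardE cardF szP ltnS leq_exp2l ?prime_gt1 // leqNgt prednK ?leqnn.
Qed.

(** The default 0 is never reached: the trace is fixed by Frobenius, hence lies in the prime
    field. *)
Definition ftrace_nat (x : F) : nat :=
  if [pick i : 'I_p | i%:R == ftrace x] is Some i then i else 0%N.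

Lemma ftrace_natE x : (ftrace_nat x)%:R = ftrace x.
Proof.
rewrite /ftrace_nat; case: pickP => [i /eqP // | no].
by have [i /eqP] := prime_subfieldP (ftraceX x); rewrite no.
Qed.

Definition psi (x : F) : algC := eps ^+ ftrace_nat x.

Lemma psi_natE x (i : nat) : i%:R = ftrace x -> psi x = eps ^+ i.
Proof.
rewrite -ftrace_natE => /eqP; rewrite natr_eqF => e.
by apply/eqP; rewrite eq_sym (eq_prim_root_expr eps_prim).
Qed.

Lemma psi0 : psi 0 = 1.
Proof. by rewrite (@psi_natE 0 0%N) ?expr0 // ftrace0. Qed.

Lemma psiD x y : psi (x + y) = psi x * psi y.
Proof.
by rewrite -exprD; apply: psi_natE; rewrite natrD !ftrace_natE ftraceD.
Qed.

Lemma psi_frob x : psi (x ^+ p) = psi x.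
Proof. by apply: psi_natE; rewrite ftrace_natE ftrace_frob. Qed.

Lemma psiMn x i : psi (i%:R * x) = psi x ^+ i.
Proof.
elim: i => [|i IHi]; first by rewrite mul0r psi0.
by rewrite -addn1 natrD mulrDl mul1r psiD IHi exprD expr1.
Qed.

Lemma psi_sum (b : F) : \sum_x psi (b * x) = #|F|%:R * (b == 0)%:R.
Proof.
have [-> | b0] := eqVneq b 0.
  by rewrite mulr1 (eq_bigr (fun=> 1)) ?sumr_const // => x _; rewrite mul0r psi0.
rewrite mulr0; have [x0 trx0] := ftrace_neq0.
have psix0 : psi x0 != 1.
  rewrite -(expr0 eps) /psi (eq_prim_root_expr eps_prim) -natr_eqF ftrace_natE.
  by [].
set S := LHS.
have: psi x0 * S = S.
  rewrite /S mulr_sumr [RHS](reindex_inj (addIr (x0 / b))) /=.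
  by apply: eq_bigr => x _; rewrite mulrDr psiD mulrCA divff // mulr1 mulrC.
move/eqP; rewrite -{2}[S]mul1r -subr_eq0 -mulrBl mulf_eq0 subr_eq0 (negPf psix0).
by move/eqP.
Qed.

Lemma psi_sum_neq0 (b : F) :
  \sum_(x | x != 0) psi (b * x) = #|F|%:R * (b == 0)%:R - 1.
Proof.
by rewrite -psi_sum [in RHS](bigD1 0) //= mulr0 psi0 addrAC subrr add0r.
Qed.

(** * Multiplicative characters as powers of [chi] *)

Let n_gt0 : (0 < n)%N := prim_order_gt0 zetaP.

Lemma delta_neq0 : delta != 0.
Proof.
apply: contra_eq_neq (prim_expr_order deltaP) => ->.
by rewrite expr0n eqn0Ngt n_gt0 eq_sym oner_neq0.
Qed.

Lemma delta_powP x : x != 0 -> exists2 l, (l < n)%N & x = delta ^+ l.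
Proof.
move=> x0; suff /(prim_rootP deltaP)[i ->]: x ^+ n = 1 by exists i.
apply: (mulfI x0); rewrite -exprS mulr1 -[RHS]expf_card cardF nE //.
Qed.

Definition dlog (x : F) : nat :=
  if [pick l : 'I_n | delta ^+ l == x] is Some l then l else 0%N.

Definition chi (x : F) : algC := if x == 0 then 0 else zeta ^+ dlog x.

Lemma chi0 : chi 0 = 0.
Proof. by rewrite /chi eqxx. Qed.

Lemma chi_pow l : chi (delta ^+ l) = zeta ^+ l.
Proof.
rewrite /chi expf_eq0 (negPf delta_neq0) andbF /dlog.
case: pickP => [i /eqP e | /(_ (Ordinal (ltn_pmod l n_gt0)))].
  by apply/eqP; rewrite (eq_prim_root_expr zetaP) -(eq_prim_root_expr deltaP) e.
by rewrite /= (prim_expr_mod deltaP) eqxx.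
Qed.

Lemma chiM : {morph chi : x y / x * y}.
Proof.
move=> x y; have [-> | /delta_powP[i _ ->]] := eqVneq x 0.
  by rewrite mul0r chi0 mul0r.
have [-> | /delta_powP[j _ ->]] := eqVneq y 0; first by rewrite mulr0 chi0 mulr0.
by rewrite -exprD !chi_pow exprD.
Qed.

Lemma chi1 : chi 1 = 1.
Proof. by rewrite -(expr0 delta) chi_pow. Qed.

Lemma chi_neq0 x : x != 0 -> chi x != 0.
Proof.
move=> x0; apply: contra_neq (oner_neq0 algC) => cx0.
by rewrite -chi1 -(divff x0) chiM cx0 mul0r.
Qed.

Lemma chiX x i : chi (x ^+ i) = chi x ^+ i.
Proof. by elim: i => [|i IHi]; rewrite ?chi1 // !exprS chiM IHi. Qed.

Lemma chiXM k : {morph (fun x => chi x ^+ k) : x y / x * y}.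
Proof. by move=> x y; rewrite chiM exprMn. Qed.

Lemma chiV x : chi x^-1 = (chi x)^-1.
Proof.
have [-> | x0] := eqVneq x 0; first by rewrite invr0 chi0 invr0.
by apply: (mulfI (chi_neq0 x0)); rewrite -chiM !divff ?chi1 ?chi_neq0.
Qed.

Lemma red_chi x : red (chi x) x^-1.
Proof.
have [-> | /delta_powP[i _ ->]] := eqVneq x 0.
  by rewrite chi0 invr0; exact: (red_nat _ _ 0).
by rewrite chi_pow -exprVn; apply/redX/red_zeta.
Qed.

Lemma chi_expn x : x != 0 -> chi x ^+ n = 1.
Proof.
by case/delta_powP => i _ ->; rewrite chi_pow -exprM mulnC exprM (prim_expr_order zetaP)
  expr1n.
Qed.

Lemma card_neq0 : #|[pred x : F | x != 0]| = n.
Proof.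
by rewrite -[RHS]/n.+1.-1 nE -cardF -(cardC1 0); apply: eq_card.
Qed.

Lemma chi_sum k : \sum_(x | x != 0) chi x ^+ k = n%:R * (n %| k)%:R.
Proof.
have [/dvdnP[d ->] | ndv] := boolP (n %| k)%N.
  rewrite mulr1 -[n in RHS]card_neq0 -sumr_const; apply: eq_bigr => x x0.
  by rewrite mulnC exprM chi_expn ?expr1n.
rewrite mulr0; apply: (sum_mult_fun0 (chiXM k) delta_neq0).
by rewrite -[X in chi X]expr1 chi_pow expr1 -(prim_order_dvd zetaP).
Qed.

Lemma sum_exprF k : \sum_(x : F | x != 0) x ^+ k = - (n %| k)%:R.
Proof.
have [/dvdnP[d ->] | ndv] := boolP (n %| k)%N.
  transitivity (\sum_(x : F | x != 0) 1 : F).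
    apply: eq_bigr => x /delta_powP[i _ ->].
    by rewrite -exprM mulnA mulnC exprM (prim_expr_order deltaP) expr1n.
  rewrite sumr_const card_neq0; apply/eqP; rewrite eq_sym -subr_eq0 -opprD oppr_eq0.
  by rewrite -mulrS nE natrX (pcharf0 pcharF) expr0n eqn0Ngt f_gt0.
rewrite oppr0; apply: (@sum_mult_fun0 F F (fun x => x ^+ k) delta).
- by move=> x y; rewrite exprMn.
- exact: delta_neq0.
- by rewrite -(prim_order_dvd deltaP).
Qed.

(** * Gauss sums and their products *)

(** The range omits 0 because [chi 0 ^+ 0] is 1, which would spoil the trivial character. *)
Definition gauss k : algC := \sum_(x | x != 0) chi x ^+ k * psi x.

Lemma gauss_twist k b : b != 0 ->
  \sum_(x | x != 0) chi x ^+ k * psi (b * x) = (chi b)^-1 ^+ k * gauss k.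
Proof.
move=> b0; rewrite /gauss [in RHS](reindex_inj (mulfI b0)) mulr_sumr /=.
apply: eq_big => x; first by rewrite mulf_eq0 (negPf b0).
by move=> _; rewrite chiXM !mulrA -exprMn mulVf ?chi_neq0 // expr1n mul1r.
Qed.

Lemma gauss_frob k : gauss (p * k) = gauss k.
Proof.
rewrite [RHS](reindex_inj (fmorph_inj (Frobenius_aut pcharF))) /=.
apply: eq_big => x; rewrite pFrobenius_autE ?expf_eq0 ?prime_gt0 // => _.
by rewrite chiX exprM psi_frob.
Qed.

(** Substituting x = u y separates the ratio [u] from [y]; the inner sum is then a twisted Gauss sum
    or a sum over one character. *)
Lemma gaussM k l : gauss k * gauss l =
  \sum_(u | u != 0) chi u ^+ k *
    \sum_(y | y != 0) chi y ^+ (k + l) * psi ((1 + u) * y).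
Proof.
under [RHS]eq_bigr do rewrite mulr_sumr.
rewrite exchange_big mulr_sumr; apply: eq_bigr => y y0 /=.
rewrite [gauss k](reindex_inj (mulIf y0)) mulr_suml /=.
apply: eq_big => u; first by rewrite mulf_eq0 (negPf y0) orbF.
move=> _; rewrite mulrDl mul1r psiD chiXM exprD.
by ring.
Qed.

(* The Jacobi sum of chi^k and chi, in the coordinate u = x / (1 - x). *)
Definition jacobi1 k : algC :=
  \sum_(u | (u != 0) && (u != -1)) chi u ^+ k * chi (1 + u)^-1 ^+ k.+1.

(** In [gaussM] the ratio u = -1 contributes a sum of the nontrivial character chi^(k+1), which is
    0; every other [u] contributes a twist of [gauss k.+1]. *)
Lemma gauss_step k : ~~ (n %| k.+1)%N ->
  gauss k * gauss 1 = jacobi1 k * gauss k.+1.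
Proof.
move=> ndv; rewrite gaussM addn1 (bigID (fun u => u != -1)) /= addrC.
rewrite big1 => [|u /andP[_]]; last first.
  rewrite negbK => /eqP ->; rewrite subrr.
  under eq_bigr do rewrite mul0r psi0 mulr1.
  by rewrite chi_sum (negPf ndv) !mulr0.
rewrite add0r mulr_suml; apply: eq_bigr => u /andP[_ u1].
by rewrite gauss_twist ?chiV ?mulrA // addrC addr_eq0.
Qed.

(** The inner sum of [gaussM] is now q [u = -1] - 1, and its constant part is killed by the
    nontrivial chi^k. *)
Lemma gauss_conj k l : ~~ (n %| k)%N -> (n %| k + l)%N ->
  gauss k * gauss l = chi (-1) ^+ k * (p ^ f)%:R.
Proof.
move=> ndv /dvdnP[d kl]; rewrite gaussM.
have inner u : \sum_(y | y != 0) chi y ^+ (k + l) * psi ((1 + u) * y) =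
    (p ^ f)%:R * (u == -1)%:R - 1.
  rewrite -cardF -(inj_eq (addrI 1)) subrr -psi_sum_neq0.
  by apply: eq_bigr => y y0; rewrite kl mulnC exprM chi_expn // expr1n mul1r.
under eq_bigr do rewrite inner mulrBr mulr1.
rewrite sumrB chi_sum (negPf ndv) mulr0 subr0 (bigD1 (-1)) ?oppr_eq0 ?oner_neq0 //=.
rewrite eqxx mulr1 big1 ?addr0 // => u /andP[_ /negPf ->].
by rewrite !mulr0.
Qed.

(** Modulo the prime, [chi] is inversion, so the Jacobi sum becomes a sum of u^(-k) (1 + u)^(k+1).
    In its binomial expansion only i = k has exponent divisible by q - 1, giving - C(k+1, k). *)
Lemma red_jacobi1 k : (0 < k < n)%N -> red (jacobi1 k) (- k.+1%:R).
Proof.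
move=> /andP[k_gt0 k_lt].
have -> : - k.+1%:R =
    \sum_(u : F | (u != 0) && (u != -1)) u^-1 ^+ k * (1 + u)^-1^-1 ^+ k.+1.
  transitivity (\sum_(u : F | u != 0) u^-1 ^+ k * (1 + u) ^+ k.+1); last first.
    rewrite (bigID (fun u => u != -1)) /= addrC big1 ?add0r.
      by apply: eq_bigr => u _; rewrite invrK.
    by move=> u /andP[_]; rewrite negbK => /eqP ->; rewrite subrr expr0n mulr0.
  transitivity (\sum_(i < k.+2) \sum_(u : F | u != 0) u ^+ (n - k + i) *+ 'C(k.+1, i)).
    under eq_bigr do rewrite sumrMnl sum_exprF.
    have k_lt2 : (k < k.+2)%N by [].
    rewrite (bigD1 (Ordinal k_lt2)) //= subnK 1?ltnW // dvdnn binSn big1 ?addr0.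
      by rewrite -mulNrn mulNrn.
    move=> i /eqP ik; rewrite (_ : (n %| _)%N = false) ?oppr0 ?mul0rn //.
    apply/negP => /dvdnP[d]; have := ltn_ord i => i_lt e.
    have ik' : i <> k :> nat by move=> e'; apply/ik/val_inj.
    by case: d e => [|[|d]] e; lia.
  rewrite exchange_big; apply: eq_bigr => u u0 /=.
  rewrite exprDn mulr_sumr; apply: eq_bigr => i _.
  rewrite expr1n mul1r mulrnAr exprD; congr (_ * _ *+ _).
  apply: (mulIf (expf_neq0 k u0)); rewrite -exprD subnK 1?ltnW //.
  by rewrite -exprMn mulVf // expr1n; case/delta_powP: u0 => j _ ->;
    rewrite -exprM mulnC exprM (prim_expr_order deltaP) expr1n.
apply: red_sum => u _; apply: redM; apply: redX; exact: red_chi.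
Qed.

(** * Stickelberger's divisibility at one prime *)

Local Notation weight := (weight p f n).

Lemma natrF_neq0 k : ~~ (p %| k)%N -> k%:R != 0 :> F.
Proof. by rewrite (dvdn_pcharf pcharF). Qed.

(* Building k from its base-p digits by the moves k -> k + 1 (without carry)
   and k -> p k shows that [gauss k] divides [gauss 1 ^+ s k], with a cofactor
   that is a unit modulo the chosen prime. *)
Lemma gauss_dvd k : (0 < k < n)%N ->
  exists s z y, [/\ gauss k * z = gauss 1 ^+ s, red z y, y != 0
                  & (p.-1 * weight k = s * n)%N].
Proof.
elim/ltn_ind: k => k IHk /andP[k_gt0 k_lt].
have [/dvdnP[k' kE] | ndv] := boolP (p %| k)%N.
  have p_gt1 := prime_gt1 p_pr.
  have k'_lt : (k' < k)%N by rewrite kE; nia.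
  have [|s [z [y [e1 e2 e3 e4]]]] := IHk k' k'_lt; first by apply/andP; split; lia.
  exists s, z, y; split=> //; rewrite kE [(k' * p)%N]mulnC.
    by rewrite gauss_frob.
  by rewrite (weight_frob f_gt0 nE).
case: k k_gt0 k_lt ndv IHk => // k _ k_lt ndv IHk.
have wS := weight_step p_pr f_gt0 nE k_lt ndv.
have [k0 | k_gt0] := posnP k.
  exists 1%N, 1, 1; rewrite wS k0 mulr1 oner_neq0; split=> //.
    exact: (red_nat _ _ 1).
  by rewrite /weight big1 ?muln0 ?mul1n // => j _; rewrite muln0 mod0n.
have [//||s [z [y [e1 e2 e3 e4]]]] := IHk k; first by rewrite k_gt0 ltnW.
exists s.+1, (jacobi1 k * z), (- k.+1%:R * y); split.
- have ndvn : ~~ (n %| k.+1)%N by rewrite gtnNdvd.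
  have := gauss_step ndvn.
  by rewrite mulrA [gauss k.+1 * _]mulrC => <-; rewrite exprS -e1; ring.
- apply: redM e2; apply: red_jacobi1.
  by rewrite k_gt0 ltnW.
- by rewrite mulf_neq0 // oppr_eq0 natrF_neq0.
- by rewrite wS e4 mulSn addnC.
Qed.

Hypothesis p_lt_n : (p < n)%N.

Let n_gt1 : (1 < n)%N.
Proof. exact: leq_trans (prime_gt1 p_pr) (ltnW p_lt_n). Qed.

Lemma gauss_pair k : (0 < k < n)%N ->
  gauss k * gauss (n - k) = chi (-1) ^+ k * (p ^ f)%:R.
Proof.
move=> /andP[k_gt0 k_lt].
apply: gauss_conj.
  by rewrite gtnNdvd.
by rewrite subnKC ?dvdnn // ltnW.
Qed.

Lemma pf_neq0 : (p ^ f)%:R != 0 :> algC.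
Proof. by rewrite pnatr_eq0 -nE. Qed.

Lemma chiN1_neq0 : chi (-1) != 0.
Proof.
by apply: chi_neq0; rewrite oppr_eq0 oner_neq0.
Qed.

Lemma gauss1_neq0 : gauss 1 != 0.
Proof.
have := @gauss_pair 1 n_gt1; apply: contra_eq_neq => ->.
by rewrite mul0r eq_sym mulf_neq0 ?pf_neq0 // expf_neq0 ?chiN1_neq0.
Qed.

(** [gauss 1] involves [eps], but this power lies in Z[zeta]: it is [gauss p.-1] times a cofactor
    with a residue, and [gauss p.-1] is a Jacobi sum because [gauss p = gauss 1]. *)
Lemma red_gauss1_pred : exists y, red (gauss 1 ^+ p.-1) y.
Proof.
have p_gt1 := prime_gt1 p_pr; have p1_gt0 : (0 < p.-1)%N by lia.
have p1_lt : (p.-1 < n)%N by lia.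
have [|s [z [y [e1 e2 _ e4]]]] := @gauss_dvd p.-1; first by rewrite p1_gt0.
have sE : s = p.-1.
  move: e4; rewrite (weight_pred p_pr f_gt0 nE p_lt_n) => /eqP.
  by rewrite eqn_pmul2r ?(ltnW n_gt1) // => /eqP.
have ndvn : ~~ (n %| p.-1.+1)%N by rewrite gtnNdvd // prednK ?prime_gt0.
have := gauss_step ndvn.
have gp : gauss p = gauss 1 by rewrite -[in LHS](muln1 p) gauss_frob.
rewrite prednK ?prime_gt0 // gp => /(mulIf gauss1_neq0) gJ.
exists (- p.-1.+1%:R * y); rewrite -[X in _ ^+ X]sE -e1 gJ; apply: redM e2.
by apply: red_jacobi1; rewrite p1_gt0.
Qed.

(* At the chosen prime P, v_P(gauss 1) = v_P(p) / (p - 1). *)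
Lemma gauss1_exp : exists z y, [/\ gauss 1 ^+ (p.-1 * f) = (p ^ f)%:R * z,
  red z y & y != 0].
Proof.
have n1 : (0 < n.-1 < n)%N by apply/andP; split; lia.
have [s [z [y [e1 e2 e3 e4]]]] := gauss_dvd n1.
(* q - 2 has digit sum [p.-1 * f - 1]; the one extra factor [gauss 1] pairs with [gauss n.-1] into q
   up to sign. *)
have sE : (p.-1 * f = s.+1)%N.
  apply/eqP; rewrite -(eqn_pmul2r (ltnW n_gt1)) mulSn -e4 -[X in (X + _)%N](sum_expn nE).
  by rewrite -mulnDr [(_ + weight _)%N]addnC (weight_max p_pr f_gt0 nE n_gt1) mulnA.
exists (chi (-1) ^+ 1 * z), ((-1)^-1 ^+ 1 * y); split.
- rewrite sE exprS -e1 mulrA -{1}(subKn (ltnW n_gt1)) subn1 mulrCA mulrA.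
  have := @gauss_pair 1 n_gt1; rewrite subn1 => <-.
  by rewrite -subn1 subKn ?(ltnW n_gt1).
- by apply: redM e2; apply/redX/red_chi.
- by rewrite mulf_neq0 // expf_neq0 // invr_eq0 oppr_eq0 oner_neq0.
Qed.

(* Stickelberger's divisibility at the chosen prime only; this is enough because the
   conclusion is about a rational integer. *)
Lemma gauss_sum_dvd (I : finType) (A : pred I) (k : I -> nat) (c : I -> algC)
    (e N : nat) (U : int) :
    ~~ (p %| N)%N -> (e <= f)%N ->
    (forall t, A t -> exists d, red (c t) d) ->
    (forall t, A t -> (0 < k t < n)%N) ->
    (forall t, A t -> exists2 w, (w <= f - e)%N & weight (n - k t) = (w * n)%N) ->
    N%:R * U%:~R = \sum_(t | A t) c t * gauss (k t) ->
  (p ^ e %| `|U|)%N.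
Proof.
move=> pN ef cred kn kw NU.
have [h hred] := red_gauss1_pred; set g1 := gauss 1 in hred *.
(* [gauss (n - k t)] divides [g1 ^+ (p.-1 * w)] and pairs with [gauss (k t)] into q up to sign, so
   this power of [g1] makes the term divisible by q. *)
have term t : A t -> exists z, exists y, red z y /\
    c t * gauss (k t) * g1 ^+ (p.-1 * (f - e)) = (p ^ f)%:R * z.
  move=> At; have /andP[k_gt0 k_lt] := kn t At.
  have [d cd] := cred t At; have [w we wE] := kw t At.
  have [|s [z [y [e1 e2 _ e4]]]] := @gauss_dvd (n - k t).
    by rewrite subn_gt0 k_lt ltn_subrL k_gt0 ltnW.
  have sE : s = (p.-1 * w)%N.
    by apply/eqP; rewrite -(eqn_pmul2r (ltnW n_gt1)) -e4 wE // mulnA.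
  exists (c t * chi (-1) ^+ k t * z * (g1 ^+ p.-1) ^+ (f - e - w)).
  exists (d * (-1)^-1 ^+ k t * y * h ^+ (f - e - w)); split.
    apply: redM; last exact: redX.
    apply: redM => //; apply: redM; first exact: cd.
    exact/redX/red_chi.
  rewrite -[in LHS](subnKC we) mulnDr exprD -sE -e1 -[in RHS]exprM.
  have := gauss_pair (kn t At) => gp.
  transitivity (c t * (gauss (k t) * gauss (n - k t)) * z * g1 ^+ (p.-1 * (f - e - w))).
    by ring.
  by rewrite gp; ring.
have {}[Z [Y [ZY NUZ]]] : exists Z, exists Y, red Z Y /\
    N%:R * U%:~R * g1 ^+ (p.-1 * (f - e)) = (p ^ f)%:R * Z.
  rewrite NU mulr_suml.
  elim/big_ind: _ => [|x1 x2 [z1 [y1 [zy1 ->]]] [z2 [y2 [zy2 ->]]]|t At].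
  - by exists 0, 0; rewrite mulr0; split=> //; exact: (red_nat _ _ 0).
  - by exists (z1 + z2), (y1 + y2); rewrite mulrDr; split=> //; apply: redD.
  - by have [z [y [zy ->]]] := term t At; exists z, y.
have {}[Z' [Y' [ZY' NUZ']]] : exists Z, exists Y, red Z Y /\
    N%:R * (`|U|%N)%:R * g1 ^+ (p.-1 * (f - e)) = (p ^ f)%:R * Z.
  case: (intP U) NUZ => [|u|u] NUZ; try by exists Z, Y.
  exists (- Z), (- Y); split; first exact: redN.
  by rewrite abszN mulrN -NUZ rmorphN /= mulrN mulNr opprK.
have [U0 | U_gt0] := posnP `|U|%N; first by rewrite U0 dvdn0.
have [u pu uE] := pfactor_coprime p_pr U_gt0; set a := logn p _ in uE.
have [ea | ae] := leqP e a; first by rewrite uE dvdn_mull // dvdn_exp2l.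
have [r [y [gE ry y0]]] := gauss1_exp.
(* Suppose the exact power p^a in [U] has a < e. The f-th power lets [gauss1_exp] replace [g1];
   after cancelling q^(f-e+a) the right side still contains p, while every factor on the left is a
   local unit. *)
have main : N%:R ^+ f * u%:R ^+ f * r ^+ (f - e)
    = (p%:R ^+ (e - a)) ^+ f * Z' ^+ f.
  have nz : ((p ^ f)%:R ^+ (f - e + a)) != 0 :> algC by rewrite expf_neq0 ?pf_neq0.
  apply: (mulfI nz).
  have := congr1 (fun x => x ^+ f) NUZ'.
  have gX : g1 ^+ (p.-1 * (f - e)) ^+ f = ((p ^ f)%:R * r) ^+ (f - e).
    by rewrite -gE -!exprM mulnAC.
  rewrite /= !exprMn gX uE natrM !exprMn => E.
  transitivity (N%:R ^+ f * (u%:R ^+ f * (p ^ a)%:R ^+ f) *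
                  ((p ^ f)%:R ^+ (f - e) * r ^+ (f - e))).
    by rewrite exprD !natrX -!exprM [(f * a)%N]mulnC; ring.
  rewrite E mulrA; congr (_ * _); rewrite natrX -!exprM -exprD; congr (_ ^+ _).
  nia.
have rl : red (N%:R ^+ f * u%:R ^+ f * r ^+ (f - e))
              (N%:R ^+ f * u%:R ^+ f * y ^+ (f - e)).
  by apply: redM; [apply: redM|]; apply: redX => //; exact: red_nat.
have rr : red ((p%:R ^+ (e - a)) ^+ f * Z' ^+ f) 0.
  have -> : 0 = (p%:R ^+ (e - a)) ^+ f * Y' ^+ f :> F.
    rewrite (pcharf0 pcharF) -exprM expr0n.
    by rewrite eqn0Ngt muln_gt0 subn_gt0 ae f_gt0 /= mul0r.
  by apply: redM; apply: redX => //; apply: redX; exact: red_nat.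
rewrite main in rl.
have /eqP := red_inj zetaP deltaVP rl rr.
rewrite mulf_eq0 mulf_eq0 !expf_eq0 (negPf y0) andbF orbF.
rewrite (negPf (natrF_neq0 pN)) andbF /=.
by rewrite (negPf (natrF_neq0 _)) ?andbF // -prime_coprime.
Qed.


(** * Character sums over connection sets *)

(** As [b] varies, these are the eigenvalues of the adjacency matrix of [Cay D]. *)
Definition charsum (D : {set F}) (b : F) : algC := \sum_(x in D) psi (b * x).

Lemma charsum0 D : charsum D 0 = #|D|%:R.
Proof. by rewrite /charsum -sumr_const; apply: eq_bigr => x _; rewrite mul0r psi0. Qed.

Lemma sum_indic (D : {set F}) (a : F) :
  \sum_(x in D) (x == a)%:R = (a \in D)%:R :> algC.
Proof.
have [aD | aD] := boolP (a \in D).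
  by rewrite (bigD1 a) //= eqxx big1 ?addr0 // => x /andP[_ /negPf->].
by rewrite big1 // => x xD; case: eqP aD => // <-; rewrite xD.
Qed.

Lemma charsum_inversion D z :
  \sum_b charsum D b * psi (- z * b) = #|F|%:R * (z \in D)%:R.
Proof.
under eq_bigr do rewrite mulr_suml.
rewrite exchange_big -sum_indic mulr_sumr; apply: eq_bigr => x _ /=.
rewrite -subr_eq0 -psi_sum; apply: eq_bigr => b _.
by rewrite -psiD [b * x]mulrC -mulrDl.
Qed.

Lemma charsum_convolution D z :
  \sum_b charsum D b * charsum D (- b) * psi (- z * b) =
    #|F|%:R * #|[set d in D | d - z \in D]|%:R.
Proof.
transitivity (\sum_(x in D) \sum_b charsum D (- b) * psi ((x - z) * b)).
  rewrite exchange_big; apply: eq_bigr => b _.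
  rewrite {1}/charsum !mulr_suml; apply: eq_bigr => x _ /=.
  by rewrite mulrDl psiD [b * x]mulrC; ring.
rewrite -sum1_card natr_sum mulr_sumr big_mkcond [RHS]big_mkcond /=.
apply: eq_bigr => x _; rewrite !inE; case: (x \in D) => //=.
rewrite (reindex_inj oppr_inj) /=.
transitivity (#|F|%:R * (x - z \in D)%:R : algC); last by case: ifP; rewrite ?mulr0.
rewrite -charsum_inversion; apply: eq_bigr => b _.
by rewrite opprK mulrN mulNr.
Qed.

(** * Strong regularity from two eigenvalues *)

(** Inverting the quadratic relation turns the square into the count [A z], the linear term into the
    indicator of [D] and the constant into 0 for z != 0. The term b = 0 adds a constant, so [A z]
    depends only on whether [z] is in [D]. *)
Lemma srg_of_two_charsums (D : {set F}) (al be : algC) (d0 z0 : F) :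
    0 \notin D -> (forall x, (- x \in D) = (x \in D)) ->
    d0 \in D -> z0 != 0 -> z0 \notin D ->
    (forall b, b != 0 -> (charsum D b - al) * (charsum D b - be) = 0) ->
  strongly_regular (Cay D).
Proof.
move=> D0 DN d0D z0n z0D two.
have csN b : charsum D (- b) = charsum D b.
  rewrite /charsum (reindex_inj oppr_inj) /=; apply: eq_big => x; first exact: DN.
  by move=> _; rewrite mulrNN.
have q_neq0 : #|F|%:R != 0 :> algC by rewrite cardF pf_neq0.
pose A z := #|[set d in D | d - z \in D]|.
have AE z : z != 0 -> #|F|%:R * (A z)%:R = (al + be) * (#|F|%:R * (z \in D)%:R) +
   (charsum D 0 - al) * (charsum D 0 - be) :> algC.
  move=> zn0; rewrite -charsum_convolution -charsum_inversion.
  have: \sum_b (- (al * be)) * psi (- z * b) = 0.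
    by rewrite -mulr_sumr psi_sum oppr_eq0 (negPf zn0) !mulr0.
  move=> e; rewrite -[RHS]addr0 -[X in _ = _ + X]e addrAC mulr_sumr -big_split /=.
  rewrite (bigD1 0) //= [in RHS](bigD1 0) //= !mulr0 psi0 csN addrAC.
  congr (_ + _); first by ring.
  apply: eq_bigr => b b0; rewrite csN.
  apply/eqP; rewrite -subr_eq0 -[X in _ == X](mul0r (psi (- z * b))) -(two b b0).
  by apply/eqP; ring.
have Aeq z z' : z != 0 -> z' != 0 -> (z \in D) = (z' \in D) -> A z = A z'.
  move=> zn z'n e; apply/eqP; rewrite -(eqr_nat algC).
  by apply/eqP/(mulfI q_neq0); rewrite !AE // e.
have nbE x y : #|neighbors (Cay D) x :&: neighbors (Cay D) y| = A (x - y).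
  rewrite /A -[RHS](card_imset _ (inv_inj (fun z => subKr x z))).
  apply: eq_card => w; apply/idP/imsetP => [|[v]].
    rewrite !inE /Cay => /andP[xw yw]; exists (x - w); last by rewrite subKr.
    by rewrite inE xw (_ : x - w - (x - y) = y - w) //; ring.
  rewrite !inE => /andP[vD vxy] ->; rewrite /Cay subKr vD.
  by rewrite (_ : y - (x - v) = v - (x - y)) //; ring.
have dn0 : d0 != 0 by apply: contraNneq D0 => <-.
exists #|F|, #|D|, (A d0), (A z0); split.
- split=> //; split=> [x y|x]; last by rewrite /Cay subrr (negPf D0).
  by rewrite /Cay -opprB DN.
- move=> x; rewrite -[RHS](card_imset _ (inv_inj (fun z => subKr x z))).
  apply: eq_card => w; rewrite inE /Cay; apply/idP/imsetP => [xw|[v vD ->]].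
    by exists (x - w); rewrite ?subKr.
  by rewrite subKr.
- split=> [/(_ z0 0 z0n)|/(_ d0 0)]; first by rewrite /Cay subr0 (negPf z0D).
  by rewrite /Cay subr0 d0D.
- move=> x y xy; rewrite nbE; apply: Aeq => //; last by rewrite d0D; exact: xy.
  by apply: contraNneq D0 => <-; exact: xy.
- move=> x y xy nxy; rewrite nbE; apply: Aeq; rewrite ?subr_eq0 //.
  by rewrite (negPf z0D); exact: negbTE nxy.
Qed.

(* Invariance under the prime field forces the character sums to be rational. *)
Lemma charsum_int (D : {set F}) b :
    (forall (i : nat) x, ~~ (p %| i)%N -> x \in D -> i%:R * x \in D) ->
  exists a : int, charsum D b = a%:~R.
Proof.
move=> Dstab; apply/intrP.
have csM i : ~~ (p %| i)%N -> charsum D (i%:R * b) = charsum D b.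
  move=> pi; have i0 := natrF_neq0 pi.
  have sub : [set i%:R * x | x in D] \subset D.
    by apply/subsetP => _ /imsetP[x xD ->]; apply: Dstab.
  have imD : [set i%:R * x | x in D] = D.
    by apply/eqP; rewrite eqEcard sub card_imset ?leqnn //; exact: mulfI i0.
  rewrite /charsum -[in RHS]imD big_imset /=; last by move=> x y _ _; apply: (mulfI i0).
  by apply: eq_bigr => x _; rewrite -mulrA mulrCA.
have psi_p y : psi y ^+ p = 1.
  by rewrite /psi -exprM mulnC exprM (prim_expr_order eps_prim) expr1n.
have orth y : \sum_(i < p) psi y ^+ i = p%:R * (psi y == 1)%:R.
  have [-> | y1] := eqVneq (psi y) 1.
    rewrite mulr1 (eq_bigr (fun=> 1)) ?sumr_const ?card_ord // => i _.
    by rewrite expr1n.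
  have := subrX1 (psi y) p; rewrite psi_p subrr mulr0 => /esym/eqP.
  by rewrite mulf_eq0 subr_eq0 (negPf y1) => /eqP.
(* Sum over the multiples i b: i = 0 gives the size of [D], the other p - 1 sums agree, and
   orthogonality counts the [x] with trivial value. Hence the sum is rational, and it is an
   algebraic integer. *)
have total : #|D|%:R + p.-1%:R * charsum D b =
    p%:R * #|[set x in D | psi (b * x) == 1]|%:R.
  transitivity (\sum_(i < p) charsum D (i%:R * b)).
    rewrite -(prednK (prime_gt0 p_pr)) big_ord_recl mul0r charsum0; congr (_ + _).
    rewrite (eq_bigr (fun=> charsum D b)) ?sumr_const ?card_ord ?mulr_natl // => i _.
    apply: csM; rewrite lift0 gtnNdvd // -[p in (_ < p)%N](prednK (prime_gt0 p_pr)).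
    by rewrite ltnS.
  rewrite exchange_big -sum1_card natr_sum mulr_sumr big_mkcond [RHS]big_mkcond /=.
  apply: eq_bigr => x _; rewrite !inE; case: (x \in D) => //=.
  transitivity (p%:R * (psi (b * x) == 1)%:R : algC); last first.
    by case: ifP; rewrite ?mulr0.
  by rewrite -orth; apply: eq_bigr => i _; rewrite -mulrA psiMn.
apply: Cint_rat_Aint.
  have p1 : p.-1%:R != 0 :> algC.
    by rewrite pnatr_eq0 -lt0n; have := prime_gt1 p_pr; lia.
  rewrite -[charsum D b](mulKf p1) -[X in _ * X](addKr #|D|%:R) total.
  by rewrite rpredM ?rpredV ?rpredD ?rpredN ?rpredM ?rpred_nat.
apply: rpred_sum => x _; apply: rpredX; exact: Aint_prim_root eps_prim.
Qed.

(** * Unions of consecutive cyclotomic classes *)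

Section ClassUnion.
Variables (D : {set F}) (ka N r L : nat).
Hypotheses (n_kaN : n = (ka * N)%N) (N_rL : N = (r * L)%N) (r_gt0 : (0 < r)%N).
Hypotheses (D0 : 0 \notin D) (DP : forall l, (delta ^+ l \in D) = (l %% N < L)%N).

Let w := zeta ^+ ka.
Let h (j : nat) : algC := r%:R * (j < L)%:R - 1.
(** Fourier coefficient on Z/N of [h], which is [r] times the indicator of [D] minus 1 read on class
    indices; [N - j] stands for the exponent -j. *)
Definition class_coef (t : nat) : algC := \sum_(j < N) h j * w ^+ (t * (N - j)).
Local Notation c := class_coef.

Let N_gt0 : (0 < N)%N.
Proof. by have := n_gt0; rewrite n_kaN muln_gt0 => /andP[]. Qed.

Let wP : N.-primitive_root w.
Proof.
have dv : (N %| n)%N by rewrite n_kaN dvdn_mull.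
by have := dvdn_prim_root zetaP dv; rewrite {1}n_kaN mulnK.
Qed.

(* Along multiples of r the characters sum to 0 over each full period L of classes. *)
Let c_eq0 t : (r %| t)%N -> c t = 0.
Proof.
case/dvdnP=> d tE; rewrite /class_coef /h.
have vL i : w ^+ (t * (i * L)) = 1.
  rewrite tE (_ : d * r * (i * L) = N * (d * i))%N; last by rewrite N_rL; ring.
  by rewrite exprM (prim_expr_order wP) expr1n.
pose g j := w ^- (t * j).
have gE (j : 'I_N) : w ^+ (t * (N - j)) = g j.
  have w0 : w ^+ (t * j) != 0.
    rewrite expf_neq0 //; apply: contra_eq_neq (prim_expr_order wP) => ->.
    by rewrite expr0n eqn0Ngt N_gt0 eq_sym oner_neq0.
  apply: (mulIf w0); rewrite mulVf // -exprD -mulnDr subnK 1?ltnW //.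
  by rewrite mulnC exprM (prim_expr_order wP) expr1n.
have gL i : g (i + L)%N = g i.
  by have := vL 1%N; rewrite mul1n /g mulnDr exprD => ->; rewrite mulr1.
have sumg : \sum_(j < N) g j = r%:R * \sum_(j < L) g j.
  by rewrite N_rL sum_periodic // mulr_natl.
have LN : (L <= N)%N by rewrite N_rL leq_pmull.
have sumgL : \sum_(j < L) g j = \sum_(j < N) (j < L)%:R * g j.
  rewrite (big_ord_widen N g LN) big_mkcond; apply: eq_bigr => j _ /=.
  by case: ifP; rewrite ?mul1r ?mul0r.
under eq_bigr do rewrite gE mulrBl mul1r.
rewrite sumrB sumg sumgL mulr_sumr -sumrB big1 // => j _.
by rewrite mulrA subrr.
Qed.

Let c_inv x : x != 0 ->
  N%:R * (r%:R * (x \in D)%:R - 1) = \sum_(t < N) c t * chi x ^+ (ka * t).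
Proof.
case/delta_powP => l _ ->; rewrite DP chi_pow.
have lN := ltn_pmod l N_gt0.
have dvdN j : (j < N)%N -> (N %| N - j + l)%N = (j == l %% N)%N.
  move=> jN; rewrite /dvdn -[X in _ == X](mod0n N) -(eqn_modDr j) add0n.
  rewrite addnAC subnK 1?ltnW // modnDl.
  by rewrite eq_sym (modn_small jN).
transitivity (\sum_(t < N) \sum_(j < N) h j * w ^+ (t * (N - j + l))).
  rewrite exchange_big (bigD1 (Ordinal lN)) //= [X in _ = _ + X]big1 ?addr0.
    rewrite -mulr_sumr (sum_prim_pow _ wP) dvdN ?eqxx //.
    by rewrite mulr1 mulrC.
  move=> j jl; rewrite -mulr_sumr (sum_prim_pow _ wP) dvdN // mulrCA.
  by rewrite -[_ == _]/(j == Ordinal lN) (negPf jl) !mulr0.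
apply: eq_bigr => t _; rewrite /class_coef mulr_suml; apply: eq_bigr => j _.
rewrite -mulrA /w -!exprM -exprD; congr (_ * _ ^+ _); ring.
Qed.

(** Terms with [r] dividing [t] drop out by [c_eq0]; when N is a power of a prime r, exactly the
    characters of order N remain. *)
Lemma class_union_expansion b : b != 0 ->
  N%:R * (r%:R * charsum D b + 1) =
    \sum_(t < N | ~~ (r %| t)%N) c t * chi b^-1 ^+ (ka * t) * gauss (ka * t).
Proof.
move=> b0.
have -> : r%:R * charsum D b + 1 =
    \sum_(x | x != 0) (r%:R * (x \in D)%:R - 1) * psi (b * x).
  under eq_bigr do rewrite mulrBl mul1r.
  rewrite sumrB psi_sum_neq0 (negPf b0) mulr0 sub0r opprK; congr (_ + _).
  rewrite mulr_sumr big_mkcond [RHS]big_mkcond; apply: eq_bigr => x _ /=.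
  have [-> | x0] := eqVneq x 0; first by rewrite (negPf D0).
  by case: (x \in D); rewrite ?mulr1 // mulr0 mul0r.
rewrite mulr_sumr [RHS]big_mkcond /=.
transitivity (\sum_(x | x != 0) \sum_(t < N) c t * chi x ^+ (ka * t) * psi (b * x)).
  by apply: eq_bigr => x x0; rewrite mulrA c_inv // mulr_suml.
rewrite exchange_big; apply: eq_bigr => t _ /=.
case: ifPn => [_ | /negbNE/c_eq0 ->]; last by rewrite big1 // => x _; rewrite !mul0r.
rewrite chiV -mulrA -gauss_twist // mulr_sumr.
by apply: eq_bigr => x _; rewrite mulrA.
Qed.

Lemma red_class_coef b t : exists d, red (c t * chi b^-1 ^+ (ka * t)) d.
Proof.
pose d := \sum_(j < N) (r%:R * (j < L)%:R - 1) * (delta^-1 ^+ ka) ^+ (t * (N - j)).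
exists (d * b^-1^-1 ^+ (ka * t)); apply: redM; last exact/redX/red_chi.
apply: red_sum => j _; apply: redM; last by apply/redX/redX/red_zeta.
by apply: redD; [apply: redM; exact: red_nat | apply/redN/(red_nat _ _ 1)].
Qed.

Lemma card_class_union : r%:R * #|D|%:R = n%:R :> algC.
Proof.
have -> : #|D|%:R = \sum_(x : F | x != 0) (x \in D)%:R :> algC.
  rewrite -sum1_card natr_sum big_mkcond [RHS]big_mkcond; apply: eq_bigr => x _ /=.
  by have [-> | _] := eqVneq x 0; [rewrite (negPf D0) | case: (x \in D)].
pose g l : algC := (l %% N < L)%:R.
have -> : \sum_(x : F | x != 0) (x \in D)%:R = \sum_(l < n) g l.
  rewrite (reindex_onto (fun l : 'I_n => delta ^+ l)
    (fun x => Ordinal (ltn_pmod (dlog x) n_gt0))) /=; last first.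
    move=> x x0; have := x0; rewrite /dlog; case: pickP => [l /eqP <- _|no].
      by rewrite modn_small.
    by have [l ln xE] := delta_powP x0; have := no (Ordinal ln); rewrite xE eqxx.
  apply: eq_big => l; last by rewrite DP.
  rewrite expf_neq0 ?delta_neq0 //=; apply/eqP/val_inj => /=.
  rewrite /dlog; case: pickP => [i | /(_ l)]; last by rewrite eqxx.
  by rewrite (eq_prim_root_expr deltaP) !modn_small // => /eqP.
rewrite n_kaN sum_periodic => [|i]; last by rewrite /g modnDr.
have -> : \sum_(l < N) g l = L%:R.
  have LN : (L <= N)%N by rewrite N_rL leq_pmull.
  transitivity (\sum_(l < L) 1 : algC); last by rewrite sumr_const card_ord.
  rewrite (big_ord_widen N (fun=> 1) LN) [RHS]big_mkcond.
  by apply: eq_bigr => l _; rewrite /g modn_small //; case: ifP.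
by rewrite -mulrnA -natrM N_rL; congr (_%:R); ring.
Qed.

(** Fourier inversion at 0, which is not in [D]. *)
Lemma class_union_moment1 : \sum_(b | b != 0) (r%:R * charsum D b + 1) = 0.
Proof.
have := charsum_inversion D 0; rewrite (negPf D0) mulr0.
under eq_bigr do rewrite oppr0 mul0r psi0 mulr1.
rewrite (bigD1 0) //= charsum0 => /eqP; rewrite addr_eq0 => /eqP e.
rewrite big_split sumr_const card_neq0 -mulr_sumr /= -card_class_union e.
by rewrite mulrN subrr.
Qed.

Hypothesis DN : forall x, (- x \in D) = (x \in D).

(** Parseval: the convolution formula at z = 0, with symmetry of [D] turning the product into a
    square. *)
Lemma class_union_moment2 :
  \sum_(b | b != 0) (r%:R * charsum D b + 1) ^+ 2 = n%:R * #|F|%:R * (r%:R - 1).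
Proof.
have := charsum_convolution D 0.
have csN b : charsum D (- b) = charsum D b.
  rewrite /charsum (reindex_inj oppr_inj) /=; apply: eq_big => x; first exact: DN.
  by move=> _; rewrite mulrNN.
under eq_bigr do rewrite oppr0 mul0r psi0 mulr1 csN.
have -> : [set d in D | d - 0 \in D] = D.
  by apply/setP => x; rewrite !inE subr0 andbb.
rewrite (bigD1 0) //= charsum0 => e.
have -> : \sum_(b | b != 0) (r%:R * charsum D b + 1) ^+ 2 =
    r%:R ^+ 2 * (\sum_(b | b != 0) charsum D b * charsum D b) +
    (\sum_(b | b != 0) (r%:R * charsum D b + 1)) *+ 2 - \sum_(b : F | b != 0) 1.
  rewrite mulr_sumr -sumrMnl -big_split -sumrB /=; apply: eq_bigr => b _; ring.
rewrite class_union_moment1 mul0rn addr0 sumr_const card_neq0.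
have -> : \sum_(b | b != 0) charsum D b * charsum D b =
   #|F|%:R * #|D|%:R - #|D|%:R * #|D|%:R by rewrite -e addrAC subrr add0r.
transitivity (r%:R * #|F|%:R * (r%:R * #|D|%:R) - (r%:R * #|D|%:R) ^+ 2 - n%:R : algC).
  by ring.
rewrite card_class_union cardF -nE -natr1; ring.
Qed.

(** By the two moments the products sum to n q (r - 1) + n x y, which the choice of x y makes 0. *)
Lemma class_union_two_values (x y : algC) :
    x * y = - (#|F|%:R * (r%:R - 1)) ->
    (forall b, b != 0 ->
       0 <= (r%:R * charsum D b + 1 - x) * (r%:R * charsum D b + 1 - y)) ->
  forall b, b != 0 -> (r%:R * charsum D b + 1 - x) * (r%:R * charsum D b + 1 - y) = 0.
Proof.
move=> xy ge0; apply: psumr_eq0P ge0 _.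
transitivity (\sum_(b | b != 0) ((r%:R * charsum D b + 1) ^+ 2
    - (x + y) * (r%:R * charsum D b + 1) + x * y)).
  by apply: eq_bigr => b _; ring.
rewrite big_split sumrB -mulr_sumr class_union_moment1 class_union_moment2 /=.
by rewrite sumr_const card_neq0 xy -mulr_natr; ring.
Qed.

End ClassUnion.

End GaussSums.

Lemma prim_rootV (F : fieldType) n (x : F) :
  n.-primitive_root x -> n.-primitive_root x^-1.
Proof.
move=> xP; have n_gt0 := prim_order_gt0 xP.
have x0 : x != 0.
  apply: contra_eq_neq (prim_expr_order xP) => ->.
  by rewrite expr0n eqn0Ngt n_gt0 eq_sym oner_neq0.
have -> : x^-1 = x ^+ n.-1.
  by apply: (mulfI x0); rewrite divff // -exprS prednK // prim_expr_order.
by rewrite (prim_root_exp_coprime _ xP) coprimePn.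
Qed.

Lemma pow_mod31 M : (exists i, M = 125 ^ i)%N -> exists u : int, M%:Z = 31 * u + 1.
Proof.
by case=> i ->; have [u ->] := pow125_mod31 i; exists u%:Z; rewrite PoszD PoszM.
Qed.

(* The two values are consecutive members of a residue class modulo 155 M. *)
Lemma two_values_sign (M : nat) (a : int) :
    (exists i, M = 125 ^ i)%N -> (5 * M %| `|(31 * a + 1)%R|)%N ->
  0 <= (31 * a + 1 - 125 * M%:Z) * (31 * a + 1 + 30 * M%:Z).
Proof.
move=> /pow_mod31[u Mu] /dvdnP[d dE].
have [v vE] : exists v : int, 31 * a + 1 = 5 * M%:Z * v.
  have e : `|31 * a + 1| = d%:Z * (5 * M%:Z) by rewrite -abszE dE !PoszM.
  have [h | h] := ger0P (31 * a + 1); [exists d%:Z | exists (- d%:Z)].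
    by rewrite [RHS]mulrC -e ger0_norm.
  by rewrite [RHS]mulrC mulNr -e ltr0_norm ?opprK.
have [t tE] : exists t : int, v = 31 * t + 25.
  exists (25 * a - 4 * v - 125 * u * v).
  have : 31 * a + 1 = 5 * (31 * u + 1) * v by rewrite -Mu.
  by move=> h; nia.
rewrite vE (_ : _ * _ = 25 * M%:Z ^+ 2 * 961 * (t * (t + 1))); last by rewrite tE; ring.
apply: mulr_ge0; first by rewrite !mulr_ge0 ?sqr_ge0.
by have [h | h] := lerP 0 t; [apply: mulr_ge0 | apply: mulr_le0]; lia.
Qed.

(** * Classes of order [31 ^ m.+1] in the field of order [5 ^ f] *)

Section Main31.
Variables (m : nat) (F : finFieldType) (gamma : F) (D : {set F}).
Let L := (31 ^ m)%N.
Let N := (31 ^ m.+1)%N.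
Let f := (3 * L)%N.
Let n := (5 ^ f - 1)%N.
Hypotheses (cardF : #|F| = (5 ^ f)%N) (gammaP : n.-primitive_root gamma).
Hypotheses (D0 : 0 \notin D) (DP : forall l, (gamma ^+ l \in D) = (l %% N < L)%N).

Let L_gt0 : (0 < L)%N. Proof. by rewrite expn_gt0. Qed.
Let f_gt0 : (0 < f)%N. Proof. by rewrite muln_gt0. Qed.
Let nE : (n.+1 = 5 ^ f)%N. Proof. by rewrite /n subn1 prednK // expn_gt0. Qed.
Let p_lt_n : (5 < n)%N.
Proof.
have : (5 ^ 3 <= 5 ^ f)%N by rewrite leq_exp2l // /f; move: L_gt0; lia.
by rewrite /n; lia.
Qed.
Let N_rL : (N = 31 * L)%N. Proof. by rewrite /N expnS. Qed.
Let dvdNn : (N %| n)%N. Proof. by rewrite /n /f expnM; exact: dvdn_pow125. Qed.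
Let ka := (n %/ N)%N.
Let n_kaN : (n = ka * N)%N. Proof. by rewrite divnK. Qed.
Let N_gt0 : (0 < N)%N. Proof. by rewrite expn_gt0. Qed.
Let ka_gt0 : (0 < ka)%N.
Proof. by have := prim_order_gt0 gammaP; rewrite n_kaN muln_gt0 => /andP[]. Qed.
Let c := (3 * (L - 1) %/ 2)%N.
Let oddL : odd L. Proof. by rewrite oddX orbT. Qed.
Let fE : (f = 2 * c + 3)%N.
Proof. by rewrite /f /c; have := L_gt0; have := oddL; move: L => l; lia. Qed.

(** The logarithm l of [y] satisfies N | 4 l, and N is odd, so [y] lies in class 0. This covers both
    -1 and the prime field units. *)
Lemma stable_root4 (y x : F) : y ^+ 4 = 1 -> x \in D -> y * x \in D.
Proof.
move=> y4 xD; have x0 : x != 0 by apply: contraNneq D0 => <-.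
have y0 : y != 0.
  by apply: contra_eq_neq y4 => ->; rewrite expr0n eq_sym oner_neq0.
have [l _ yE] := delta_powP cardF nE gammaP y0.
have [a _ xE] := delta_powP cardF nE gammaP x0.
have /dvdnP[d lE] : (N %| l)%N.
  have : (n %| l * 4)%N by rewrite (prim_order_dvd gammaP) exprM -yE y4.
  by move/(dvdn_trans dvdNn); rewrite Gauss_dvdl // coprimeXl.
by move: xD; rewrite xE yE -exprD !DP lE modnMDl.
Qed.

Lemma cyclotomic_union_srg : strongly_regular (Cay D).
Proof.
have [zeta zetaP] := C_prim_root_exists (prim_order_gt0 gammaP).
have [eps epsP] := @C_prim_root_exists 5 isT.
have p_pr : prime 5 by [].
have gammaVP := prim_rootV gammaP.
have DN x : (- x \in D) = (x \in D).
  have oppD y : y \in D -> - y \in D.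
    by rewrite -mulN1r; apply: stable_root4; rewrite -signr_odd.
  by apply/idP/idP => [/oppD|/oppD //]; rewrite opprK.
pose cs b := charsum 5 f eps D b.
have cs_int b : exists a : int, cs b = a%:~R.
  apply: (charsum_int p_pr f_gt0 cardF nE epsP zetaP gammaP gammaVP p_lt_n) => i x pi xD.
  apply: stable_root4 xD; apply/eqP; rewrite -natrX -[1]/(1%:R) (natr_eqF p_pr cardF).
  by apply/eqP/(@Euler_exp_totient i 5); rewrite coprime_sym prime_coprime.
have U_dvd b (a : int) : b != 0 -> cs b = a%:~R ->
    (5 ^ c.+1 %| `|(31 * a + 1)%R|)%N.
  move=> b0 csE.
  have := class_union_expansion p_pr f_gt0 cardF nE epsP zetaP gammaP n_kaN
    N_rL isT D0 DP b0.
  rewrite -/(cs b) csE.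
  have -> : 31%:R * a%:~R + 1 = (31 * a + 1)%:~R :> algC by rewrite rmorphD rmorphM.
  apply: (gauss_sum_dvd p_pr f_gt0 cardF nE epsP zetaP gammaP gammaVP p_lt_n).
  - by rewrite /N Euclid_dvdX //.
  - by rewrite fE; lia.
  - by move=> t _; exact: (red_class_coef cardF nE zetaP gammaP).
  - move=> t t31; have := ltn_ord t; rewrite n_kaN ltn_pmul2l // => ->.
    by rewrite muln_gt0 ka_gt0 andbT lt0n; apply: contraNneq t31 => ->.
  - move=> t t31; have tN := ltn_ord t.
    have t31' : ~~ (31 %| N - t)%N.
      apply: contra t31 => h; rewrite -(subKn (ltnW tN)) dvdn_sub //.
      by rewrite N_rL dvdn_mulr.
    have [r r_bd rE] := orbit_pow5 m t31'.
    (* With e = c + 1 the allowance f - e is c + 2, and r <= 2. *)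
    exists (c + r)%N; first by rewrite fE; lia.
    rewrite /weight n_kaN -mulnBr.
    under eq_bigr do rewrite mulnCA -muln_modr.
    by rewrite -big_distrr /= rE -/N -/L -/c; ring.
pose M := (5 ^ c)%N.
have M125 : (exists i, M = 125 ^ i)%N.
  exists ((L - 1) %/ 2)%N; rewrite -[125%N]/(5 ^ 3)%N -expnM; congr (_ ^ _)%N.
  by rewrite /c; have := oddL; move: L => l; lia.
have qM : (5 ^ f = 125 * M * M)%N by rewrite fE expnD mul2n -addnn expnD; lia.
(* The product of 125 M and -30 M is -30 q, as q = 125 M^2 and r - 1 = 30. *)
have key b : b != 0 ->
    (31%:R * cs b + 1 - (125 * M)%:R) * (31%:R * cs b + 1 - (- (30 * M)%:R)) = 0.
  apply: (class_union_two_values p_pr f_gt0 cardF nE epsP zetaP gammaP n_kaN N_rL isT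
    D0 DP DN).
    by rewrite cardF qM !natrM; ring.
  move=> {}b b0; have [a csE] := cs_int b; rewrite -/(cs b) csE.
  have := U_dvd b a b0 csE; rewrite expnS => /(two_values_sign M125).
  rewrite -(ler0z algC); congr (0 <= _).
  by rewrite !natrM !(rmorphM, rmorphD, rmorphN) /= -!pmulrn opprK.
(* The eigenvalues are recovered from U = 31 S + 1; 1 lies in class 0 and [gamma ^+ L] in the first
   class outside [D]. *)
apply: (@srg_of_two_charsums F 5 f n eps p_pr f_gt0 cardF nE epsP D
  (((125 * M)%:R - 1) / 31%:R) ((- (30 * M)%:R - 1) / 31%:R) 1 (gamma ^+ L)) => //.
- by rewrite -(expr0 gamma) DP mod0n.
- by rewrite expf_neq0 //; exact: (delta_neq0 zetaP gammaP).
- by rewrite DP modn_small ?ltnn // N_rL; lia.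
- move=> b /key; rewrite -/(cs b) => e.
  have r31 : 31%:R != 0 :> algC by rewrite pnatr_eq0.
  by apply: (mulfI (expf_neq0 2 r31)); rewrite mulr0 -e; field.
Qed.

End Main31.

(** * Membership in the union of classes read off discrete logarithms *)

Theorem mainTheorem5 :
  forall m : nat, (1 <= m)%N ->
  let N := (31 ^ m)%N in
  let f := (totient (31 ^ m) %/ 10)%N in
  let q := (5 ^ f)%N in
  forall (F : finFieldType) (gamma : F),
    #|F| = q ->
    (q - 1).-primitive_root gamma ->
    let C := fun i : nat => cyclotomic_class gamma q N i in
    let D := \bigcup_(i < 31 ^ (m - 1)) C i in
    strongly_regular (Cay D).
Proof.
(* From here the exponent is [m.+1], and the totient is 30 * 31^m. *)
case=> // m _ N f; have -> : f = (3 * 31 ^ m)%N.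
  by rewrite /f totient_pfactor //= (_ : 30 * 31 ^ m = 3 * 31 ^ m * 10)%N ?mulnK //; lia.
move=> q F gamma cardF gammaP C D.
have dvdN : (N %| q - 1)%N by rewrite /q expnM; exact: dvdn_pow125.
have q1_gt0 := prim_order_gt0 gammaP.
have N_gt0 : (0 < N)%N by rewrite expn_gt0.
have gamma0 : gamma != 0.
  apply: contra_eq_neq (prim_expr_order gammaP) => ->.
  by rewrite expr0n eqn0Ngt q1_gt0 eq_sym oner_neq0.
apply: (@cyclotomic_union_srg m F gamma D cardF gammaP).
  apply/bigcupP => -[i _ /imsetP[j _ /esym/eqP]].
  by rewrite expf_eq0 (negPf gamma0) andbF.
move=> l; apply/bigcupP/idP => [[i _ /imsetP[j _ /eqP]] | lt_l].
  rewrite (eq_prim_root_expr gammaP) => /eqP e.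
  have i_lt : (i < 31 ^ m)%N by apply: leq_trans (ltn_ord i) _; rewrite subn1.
  have iN : (i < N)%N by rewrite /N expnS; lia.
  rewrite -(modn_dvdm l dvdN) e modn_dvdm // addnC modnMDl modn_small //.
(* Reducing [l] modulo q - 1 keeps the quotient by N within the range of [j], and preserves the
   class since N divides q - 1. *)
pose l' := (l %% (q - 1))%N.
have lE : (l' %% N = l %% N)%N by rewrite modn_dvdm.
have lt_l' : (l %% N < 31 ^ (m.+1 - 1))%N by rewrite subn1.
exists (Ordinal lt_l') => //; apply/imsetP.
have jP : (l' %/ N < (q - 1) %/ N)%N.
  by rewrite ltn_divLR // divnK // ltn_pmod.
exists (Ordinal jP) => //=.
by rewrite -lE addnC -divn_eq prim_expr_mod.
Qed.
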